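(* Let $\mathbb{F}_q$ be a finite field of characteristic three, let $\sigma\in\mathbb{F}_q$ be a nonsquare, and let $n>1$ be an integer. Then \[ |\mathcal{I}(x^3-x,\,1,\,n,\,q)|=\frac{2}{3n_3}\,I\bigl(n/n_3,q^{n_3}\bigr), \] and \[ |\mathcal{I}(x^3-\sigma x,\,1,\,n,\,q)|=\frac{1}{3n_3}\,I\bigl(n/(2n_3),q^{2n_3}\bigr). \]
   Context: For coprime $g,h\in\mathbb{F}_q[x]$ and an integer $n>1$, $\mathcal{I}(g,h,n,q)$ denotes the set of monic irreducible polynomials $f\in\mathbb{F}_q[x]$ of degree $n$ such that $h(x)^n f\bigl(g(x)/h(x)\bigr)$ is irreducible in $\mathbb{F}_q[x]$. $n_3$ denotes the largest power of $3$ dividing $n$. For a positive integer $k$ and an integer $Q$, $I(k,Q)=\frac1k\sum_{d\mid k}\mu(d)Q^{k/d}$, where $\mu$ is the Möbius function; $I(k,Q)=0$ by convention when $k$ is not a positive integer. *)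

(* Defs.v *)
From HB Require Import structures.
From mathcomp Require Import all_boot all_order all_algebra.
From mathcomp Require Import archimedean fraction qpoly.

Set Implicit Arguments.
Unset Strict Implicit.
Unset Printing Implicit Defensive.

Import Order.TTheory GRing.Theory Num.Theory.
Local Open Scope ring_scope.

Local Notation "x %:F" := (tofrac x) : ring_scope.

Definition irredb (F : finFieldType) (p : {poly F}) : bool :=
  irreducibleb (NPoly (leqnn (size p) : p \is a poly_of_size (size p))).

Lemma irredP (F : finFieldType) (p : {poly F}) :
  reflect (irreducible_poly p) (irredb p).
Proof. exact: irreducibleP. Qed.

(* For size f <= n.+1, this is the polynomial h ^+ n * f(g / h), the
   denominators being cleared; see ratsubstE. *)
Definition ratsubst (F : fieldType) (g h : {poly F}) (n : nat) (f : {poly F}) :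
    {poly F} :=
  \sum_(i < n.+1) f`_i *: (g ^+ i * h ^+ (n - i)).

Lemma ratsubstE (F : fieldType) (g h : {poly F}) (n : nat) (f : {poly F}) :
  h != 0 -> (size f <= n.+1)%N ->
  (ratsubst g h n f)%:F =
    h%:F ^+ n * (map_poly (fun c : F => (c%:P)%:F) f).[g%:F / h%:F].
Proof.
move=> hn0 sf.
have hF : h%:F != 0 by rewrite tofrac_eq0.
have f0 : (0 : F)%:P%:F = 0 by rewrite polyC0 tofrac0.
rewrite (@horner_coef_wide _ n.+1); last first.
  exact: leq_trans (size_poly _ _) sf.
rewrite /ratsubst rmorph_sum mulr_sumr; apply: eq_bigr => i _ /=.
rewrite coef_map_id0 // -mul_polyC !tofracM !tofracXn.
have le_in : (i <= n)%N by rewrite -ltnS.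
have -> : h%:F ^+ n = h%:F ^+ (n - i) * h%:F ^+ i by rewrite -exprD subnK.
have hi : h%:F ^+ i != 0 by rewrite expf_neq0.
rewrite expr_div_n [RHS]mulrCA; congr (_ * _).
by rewrite [_ / _]mulrC mulrA mulfK // mulrC.
Qed.

(* The bound in {poly_n.+1 F} only makes the ambient type finite: it is implied
   by the degree condition. *)
Definition Iset (F : finFieldType) (g h : {poly F}) (n : nat) :
    {set {poly_n.+1 F}} :=
  [set f : {poly_n.+1 F} |
    [&& (f : {poly F}) \is monic, size f == n.+1, irredb f
      & irredb (ratsubst g h n f)]].

Definition moebius (n : nat) : int :=
  if (0 < n)%N && all (fun p => ~~ (p ^ 2 %| n)%N) (primes n)
  then (-1) ^+ size (primes n) else 0.

(* The first argument is rational, so that the value 0 when k is not a positive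
   integer is part of the definition. *)
Definition Ifun (k : rat) (Q : int) : rat :=
  if (k \is a Num.nat) && (0 < k) then
    k^-1 * \sum_(d <- divisors (Num.truncn k))
             (moebius d)%:~R * Q%:~R ^+ (Num.truncn k %/ d)
  else 0.

Lemma IfunE (k : nat) (Q : int) : (0 < k)%N ->
  Ifun k%:R Q =
    k%:R^-1 * \sum_(d <- divisors k) (moebius d)%:~R * Q%:~R ^+ (k %/ d).
Proof. by move=> k0; rewrite /Ifun natr_nat ltr0n k0 natrK. Qed.

Lemma Ifun0 (k : rat) (Q : int) :
  ~ (exists2 m : nat, (0 < m)%N & k = m%:R) -> Ifun k Q = 0.
Proof.
rewrite /Ifun => nk; case: ifP => // /andP[/natrP[m km] k0]; case: nk.
by exists m => //; rewrite -(ltr0n rat) -km.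
Qed.

(* Main.v *)
Require Import Defs.
From HB Require Import structures.
From mathcomp Require Import all_boot all_order all_algebra.
From mathcomp Require Import archimedean fraction qpoly.
From mathcomp Require Import separable closed_field finfield.
From mathcomp Require Import ring.
Import Order.TTheory GRing.Theory Num.Theory.
Local Open Scope ring_scope.

Set Implicit Arguments.
Unset Strict Implicit.
Unset Printing Implicit Defensive.

(** Write q for the order of F, and let K be an algebraic closure of F. The
    elements of K fixed by the k-th power of Frobenius form the field of q ^ k
    elements, and the monic irreducible polynomials of degree n over F are the
    Frobenius orbits of length n in K ([minimal_poly], [card_by_roots]). So n
    times the cardinal to compute is the number of the roots a, of degree n, of
    the polynomials f that are counted.

    Take s in K with s ^+ 2 = c, where c is 1 or sigma, and let b be a root of
    X^3 - c X = a. Then y = b / s satisfies y ^+ 3 - y = a / s ^+ 3. The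
    polynomial f (X^3 - c X) has degree 3 n and root b, so it is irreducible if
    and only if the orbit of b has length 3 n. If the n-th power of Frobenius
    fixes s, it translates y by the trace t of a / s ^+ 3 from F_(q ^ n) to F_3,
    because the sum defining the trace of y ^+ 3 - y telescopes; the orbit of b
    has length 3 n if t is nonzero and n otherwise ([irreducible_subst]). If it
    maps s to - s, which happens when c = sigma and n is odd, its square fixes
    b, and no f qualifies ([reducible_subst]).

    It remains to count the a of degree n such that a / s ^+ 3 has nonzero
    trace. Moebius inversion over the subfields ([count_has_period]) reduces
    this to the same count in F_(q ^ (n / e)), for each divisor e of n. If s is
    in that subfield, the trace from F_(q ^ n) is e times the trace from the
    subfield, which vanishes on exactly a third of the elements; so the count
    is 0 if 3 divides e and 2 q ^ (n / e) / 3 otherwise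
    ([count_fixed_trace]). If s is not in the subfield, the Frobenius of the
    subfield maps s to - s, hence a / s ^+ 3 to its opposite, so the trace is
    already zero in the quadratic extension of the subfield and the count is 0
    ([count_antifixed_trace]). The e that survive are the divisors of n / n_3,
    respectively n / (2 n_3), and the sum is the one in the definition of
    [Ifun] ([necklace_of_sieve]).

    Before the final evaluation, the characteristic is any prime p, with
    X^p - c X for the substitution and s ^+ p.-1 = c. *)

(** * Moebius inversion *)

Lemma moebius_mulp (p d : nat) : prime p -> ~~ (p %| d)%N -> (0 < d)%N ->
  moebius (p * d) = - moebius d.
Proof.
move=> pr_p npd d_gt0; have p_gt0 := prime_gt0 pr_p.
have pd_primes : perm_eq (primes (p * d)) (p :: primes d).
  apply: uniq_perm; rewrite ?primes_uniq //=.
    by rewrite primes_uniq mem_primes pr_p d_gt0 (negPf npd).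
  by move=> r; rewrite primesM // primes_prime // !inE.
rewrite /moebius muln_gt0 p_gt0 d_gt0 (perm_all _ pd_primes).
rewrite (perm_size pd_primes) /=.
have -> : (p ^ 2 %| p * d)%N = false.
  by rewrite expnS expn1 dvdn_pmul2l // (negPf npd).
rewrite /=.
have /eq_in_all -> : {in primes d, forall r,
    ~~ (r ^ 2 %| p * d)%N = ~~ (r ^ 2 %| d)%N}.
  move=> r; rewrite mem_primes => /and3P[pr_r _ rd].
  rewrite Gauss_dvdr // coprimeXl // prime_coprime //.
  by rewrite dvdn_prime2 //; apply: contraNneq npd => <-.
by case: ifP => _; rewrite ?oppr0 // exprS mulN1r.
Qed.

Lemma moebius_sqr (p d : nat) : prime p -> (p ^ 2 %| d)%N -> moebius d = 0.
Proof.
move=> pr_p p2d; rewrite /moebius; case: ifP => // /andP[d_gt0 /allP/(_ p)].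
rewrite mem_primes pr_p d_gt0 (dvdn_trans _ p2d) ?dvdn_mulr // => /(_ isT).
by rewrite p2d.
Qed.

Lemma sum_moebius (n : nat) : (0 < n)%N ->
  \sum_(d <- divisors n) moebius d = (n == 1%N)%:R.
Proof.
move=> n_gt0; have [->|n_neq1] := eqVneq n 1%N; first by rewrite big_seq1.
have n_gt1 : (1 < n)%N by rewrite ltn_neqAle eq_sym n_neq1.
pose p := pdiv n; have pr_p : prime p := pdiv_prime n_gt1.
have p_gt0 := prime_gt0 pr_p.
pose A := [seq d <- divisors n | ~~ (p %| d)%N].
have memA d : (d \in A) = (d %| n)%N && ~~ (p %| d)%N.
  by rewrite mem_filter andbC -dvdn_divisors.
(* Multiplication by p pairs the divisors prime to p with the ones divisible
   by p exactly once, with opposite signs; the others have a square factor. *)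
rewrite (bigID (fun d => ~~ (p %| d)%N)) /= -big_filter -/A.
rewrite [X in _ + X](bigID (fun d => (p ^ 2 %| d)%N)) /=.
rewrite [X in _ + (X + _)]big1 ?add0r; last first.
  by move=> d /andP[_]; apply: moebius_sqr.
have /(perm_big _) pA : perm_eq [seq d <- divisors n |
    ~~ ~~ (p %| d)%N && ~~ (p ^ 2 %| d)%N] [seq (p * d)%N | d <- A].
  apply: uniq_perm; rewrite ?filter_uniq ?divisors_uniq //.
    rewrite map_inj_uniq ?filter_uniq ?divisors_uniq // => d e /eqP.
    by rewrite eqn_pmul2l // => /eqP.
  move=> e; rewrite mem_filter negbK -dvdn_divisors //.
  apply/idP/mapP => [/andP[/andP[/dvdnP[d ->] np2] dn]|[d]].
    exists d; last by rewrite mulnC.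
    move: np2 dn; rewrite memA mulnC expnS expn1 dvdn_pmul2l // => -> pdn.
    by rewrite andbT (dvdn_trans _ pdn) // dvdn_mull.
  rewrite memA => /andP[dn npd] ->; rewrite dvdn_mulr // expnS expn1.
  rewrite dvdn_pmul2l // npd Gauss_dvd ?pdiv_dvd // prime_coprime //.
rewrite -[X in _ + X]big_filter pA big_map -big_split big_seq big1 //= => d.
rewrite memA => /andP[dn npd]; rewrite moebius_mulp // ?subrr //.
exact: dvdn_gt0 dn.
Qed.

(** The e such that d divides n / e are the divisors of n / d; with d the degree
    of an element over F, this is what inverts the count over subfields. *)
Lemma sum_moebius_dvd (d n : nat) : (0 < n)%N -> (d %| n)%N ->
  \sum_(e <- divisors n) moebius e *+ (d %| n %/ e)%N = (d == n)%:R.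
Proof.
move=> n_gt0 dn; have d_gt0 := dvdn_gt0 n_gt0 dn.
have m_gt0 : (0 < n %/ d)%N by rewrite divn_gt0 // dvdn_leq.
have /(perm_big _) pE : perm_eq [seq e <- divisors n | (d %| n %/ e)%N]
    (divisors (n %/ d)).
  apply: uniq_perm; rewrite ?filter_uniq ?divisors_uniq // => e.
  rewrite mem_filter -!dvdn_divisors //.
  apply/andP/idP => [[d_ne en]|e_nd].
    by rewrite dvdn_divRL // mulnC -dvdn_divRL.
  have en : (e %| n)%N by rewrite (dvdn_trans e_nd) // dvdn_div.
  by rewrite dvdn_divRL // mulnC -dvdn_divRL.
under eq_bigr do rewrite mulrb.
rewrite -big_mkcond /= -big_filter pE sum_moebius //; congr (nat_of_bool _)%:R.
by rewrite eq_sym eqn_div // mul1n.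
Qed.
(** * Polynomials over fields *)

Lemma separable_roots (K : closedFieldType) (P : {poly K}) : separable_poly P ->
  {s : seq K | [/\ uniq s, s =i root P & (size s).+1 = size P]}.
Proof.
move=> sepP; have P0 := separable_poly_neq0 sepP.
have [s Ds] := closed_field_poly_normal P; exists s.
have lc0 : lead_coef P != 0 by rewrite lead_coef_eq0.
move: sepP; rewrite Ds (eqp_separable (eqp_scale _ _)) //.
rewrite separable_prod_XsubC size_scale // size_prod_XsubC => uniq_s.
by split=> // x; rewrite [RHS]rootZ // root_prod_XsubC.
Qed.

Lemma monic_dvd_eq (F : fieldType) (f g : {poly F}) :
  f \is monic -> g \is monic -> size f = size g -> f %| g -> f = g.
Proof.
move=> fm gm size_fg fg; apply/eqP; rewrite -eqp_monic //.
by rewrite -dvdp_size_eqp // size_fg.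
Qed.

Definition monic_irreducible (F : fieldType) (n : nat) (f : {poly F}) : Prop :=
  [/\ f \is monic, size f = n.+1 & irreducible_poly f].

(** * Frobenius orbits in an algebraic closure *)

Section Frobenius.

Variables (F : finFieldType) (K : closedFieldType) (em : {rmorphism F -> K}).
Variables (p : nat) (charF : p \in [pchar F]).

Let charK : p \in [pchar K]. Proof. exact: rmorph_pchar em _ charF. Qed.

Lemma card_pfield : #|F| = (p ^ logn p #|F|)%N.
Proof. exact: (card_pprimeChar charF). Qed.

Lemma logn_card_gt0 : (0 < logn p #|F|)%N.
Proof.
by have := finNzRing_gt1 F; rewrite {1}card_pfield; case: (logn _ _).
Qed.

Definition frob (j : nat) (x : K) : K := x ^+ (#|F| ^ j).

Lemma frob_is_zmod_morphism j : zmod_morphism (frob j).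
Proof.
have pnat : [pchar K].-nat (#|F| ^ j)%N.
  rewrite [X in (X ^ _)%N]card_pfield (eq_pnat _ (pcharf_eq charK)) !pnatX.
  by rewrite pnat_id ?(pcharf_prime charK).
move=> x y; rewrite /frob; apply: (addIr (y ^+ (#|F| ^ j))).
by rewrite subrK -exprDn_pchar // subrK.
Qed.

Lemma frob_is_monoid_morphism j : monoid_morphism (frob j).
Proof. by split=> [|x y]; rewrite /frob ?expr1n ?exprMn. Qed.

HB.instance Definition _ j :=
  GRing.isZmodMorphism.Build K K (frob j) (frob_is_zmod_morphism j).
HB.instance Definition _ j :=
  GRing.isMonoidMorphism.Build K K (frob j) (frob_is_monoid_morphism j).

Lemma frob0 x : frob 0 x = x. Proof. by rewrite /frob expn0 expr1. Qed.

Lemma frobD i j x : frob (i + j) x = frob i (frob j x).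
Proof. by rewrite /frob -exprM -expnD addnC. Qed.

Lemma frob_em j a : frob j (em a) = em a.
Proof.
elim: j => [|j IHj]; first exact: frob0.
by rewrite -add1n frobD IHj /frob expn1 -rmorphXn expf_card.
Qed.

Lemma frob1_em x : frob 1 x = x -> exists a, x = em a.
Proof.
rewrite /frob expn1 => xq.
have : root (map_poly em ('X^#|F| - 'X)) x.
  by rewrite rmorphB /= map_polyXn map_polyX /root !hornerE xq subrr.
rewrite finField_genPoly map_prod_XsubC -big_enum.
rewrite -(big_map _ xpredT (fun z => 'X - z%:P)) root_prod_XsubC.
by case/mapP=> a _ ->; exists a.
Qed.

(** The size of the Frobenius orbit of x, characterized by divisibility so that
    it determines all the fields fixed by a power of Frobenius which contain
    x. *)
Definition period (x : K) (d : nat) : Prop :=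
  (0 < d)%N /\ forall j, (frob j x == x) = (d %| j)%N.

Lemma frob_mul j k x : frob j x = x -> frob (k * j) x = x.
Proof.
by move=> xj; elim: k => [|k IHk]; rewrite ?frob0 // mulSn frobD IHk.
Qed.

Lemma period_fix x d : period x d -> frob d x = x.
Proof. by case=> _ /(_ d); rewrite dvdnn => /eqP. Qed.

Lemma period_inj x d e : period x d -> period x e -> d = e.
Proof.
case=> _ Pd [_ Pe]; apply/eqP.
by rewrite eqn_dvd -Pd -Pe Pe Pd !dvdnn.
Qed.

Lemma period_exists x j : (0 < j)%N -> frob j x = x -> exists d, period x d.
Proof.
move=> j_gt0 xj.
have ex : exists d, (0 < d)%N && (frob d x == x).
  by exists j; rewrite j_gt0 xj eqxx.
case: (ex_minnP ex) => d /andP[d_gt0 /eqP xd] min_d; exists d; split=> // k.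
rewrite {1}(divn_eq k d) addnC frobD frob_mul // /dvdn.
apply/idP/eqP => [xr|->]; last by rewrite frob0.
have [//|r_gt0] := posnP (k %% d)%N.
by have := ltn_pmod k d_gt0; rewrite ltnNge min_d // r_gt0.
Qed.

Lemma frob_root (f : {poly F}) x j :
  root (map_poly em f) x -> root (map_poly em f) (frob j x).
Proof.
move/(rmorph_root (frob j)); rewrite -map_poly_comp.
by congr (root _ _); apply: eq_map_poly => a; apply: frob_em.
Qed.

(** Frobenius maps the finite set of roots of f to itself injectively, so the
    iterates of x return to x. *)
Lemma root_period (f : {poly F}) x :
  f != 0 -> root (map_poly em f) x -> exists d, period x d.
Proof.
move=> f0 fx; pose s := mkseq (frob^~ x) (size f).
have : ~~ uniq s.
  apply: contraTN isT => /(max_poly_roots (p := map_poly em f)).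
  rewrite size_mkseq size_map_poly ltnn map_poly_eq0 f0; apply => //.
  by apply/allP => _ /mapP[j _ ->]; apply: frob_root.
case/(uniqPn 0) => i [j [ij]]; rewrite size_mkseq => js.
rewrite !nth_mkseq ?(ltn_trans ij) // => eq_ij.
apply: (@period_exists _ (j - i)); first by rewrite subn_gt0.
by apply: (fmorph_inj (frob i)); rewrite /= -frobD subnKC // ltnW.
Qed.

Lemma uniq_orbit x d : period x d -> uniq (mkseq (frob^~ x) d).
Proof.
case=> _ Pd; apply/mkseq_uniqP => i j; rewrite !inE.
wlog ij : i j / (i <= j)%N => [ih id jd eq_ij|].
  by have [/ih->|/ltnW/ih->] := leqP i j.
move=> _ jd; rewrite -(subnKC ij) frobD => /fmorph_inj/esym/eqP.
rewrite Pd => /dvdn_leq; rewrite subn_gt0.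
case: ltngtP ij => // [ij _ /(_ isT)|<- _ _]; last by rewrite subnn addn0.
by move=> /(leq_trans jd); rewrite ltnNge leq_subr.
Qed.

(** The product over the Frobenius orbit of x is fixed by Frobenius, so it
    descends to F; it is therefore the minimal polynomial of x. *)
Lemma minimal_poly x d : period x d ->
  exists f : {poly F}, [/\ f \is monic, size f = d.+1,
    map_poly em f = \prod_(z <- mkseq (frob^~ x) d) ('X - z%:P)
    & forall g : {poly F}, root (map_poly em g) x = (f %| g)].
Proof.
move=> per_x; have [d_gt0 Pd] := per_x; set P := \prod_(_ <- _) _.
have P_frob : map_poly (frob 1) P = P.
  rewrite /P map_prod_XsubC !big_map /=.
  under eq_bigr do rewrite -frobD add1n.
  case: d per_x {d_gt0 Pd P} => [[]//|d] /period_fix xd.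
  rewrite -[iota 0 d.+1]/(index_iota 0 d.+1) big_nat_recr //= big_nat_recl //=.
  by rewrite xd frob0 mulrC.
have [f Df] : exists f, map_poly em f = P.
  have Pi i : exists a, P`_i == em a.
    have /frob1_em[a ->] : frob 1 P`_i = P`_i by rewrite -coef_map P_frob.
    by exists a.
  exists (\poly_(i < size P) xchoose (Pi i)); apply/polyP=> i.
  rewrite coef_map coef_poly; case: ltnP => [_|Pi0].
    exact/esym/eqP/(xchooseP (Pi i)).
  by rewrite /= rmorph0 nth_default.
exists f; split=> //.
- by rewrite -(map_monic em) Df monic_prod_XsubC.
- by rewrite -(size_map_poly em) Df size_prod_XsubC size_mkseq.
move=> g; apply/idP/idP => [gx|fg].
  rewrite -(dvdp_map em) Df uniq_roots_dvdp ?uniq_rootsE ?(uniq_orbit per_x) //.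
  by apply/allP => _ /mapP[j _ ->]; apply: frob_root.
have : root (map_poly em f) x.
  rewrite Df root_prod_XsubC; apply/mapP; exists 0%N; rewrite ?frob0 //.
  by rewrite mem_iota.
by move: fg; rewrite -(dvdp_map em) => /dvdpP[h ->] fx; rewrite rootM fx orbT.
Qed.

(** Over a finite field, irreducibility is the maximality of a Frobenius orbit:
    the minimal polynomial of x divides f and has the length of the orbit as its
    degree. *)
Lemma irreducible_period (f : {poly F}) x d :
  root (map_poly em f) x -> period x d ->
  irreducible_poly f <-> size f = d.+1.
Proof.
move=> fx per_x; have d_gt0 : (0 < d)%N by case: per_x.
have [m [_ size_m _ root_m]] := minimal_poly per_x.
have mf : m %| f by rewrite -root_m.
split=> [[_ /(_ m)]|size_f].
  by rewrite size_m gtn_eqF // => /(_ isT mf)/eqp_size <-; rewrite size_m.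
have m0 : m != 0 by rewrite -size_poly_gt0 size_m.
have f0 : f != 0 by rewrite -size_poly_gt0 size_f.
split=> [|g g1 gf]; first by rewrite size_f.
case/dvdpP: (gf) fx f0 size_f => h Df.
rewrite {1}Df rmorphM rootM !root_m => /orP[mh|mg] f0 size_f; last first.
  have : m %= f by rewrite -dvdp_size_eqp // size_f size_m.
  by move/eqp_dvdl=> mf_g; rewrite /eqp gf -mf_g.
have := f0; rewrite {1}Df mulf_eq0 => /norP[h0 g0].
have := dvdp_leq h0 mh; rewrite size_m.
move: size_f; rewrite Df size_mul //.
have := size_poly_gt0 g; rewrite g0; move: g1.
by case: (size g) => [|[|k]] // _ _ <-; rewrite !addnS /= ltnNge leq_addr.
Qed.

(** * Fixed fields of the powers of Frobenius *)

Lemma natr_card_pow k : (0 < k)%N -> (#|F| ^ k)%:R = 0 :> K.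
Proof.
move=> k_gt0; apply/eqP; rewrite -(dvdn_pcharf charK).
by rewrite [X in (X ^ _)%N]card_pfield -expnM dvdn_exp ?muln_gt0 ?logn_card_gt0.
Qed.

Lemma separable_Xq_subX k : (0 < k)%N ->
  separable_poly ('X^(#|F| ^ k) - 'X : {poly K}).
Proof.
move=> k_gt0; rewrite unlock derivB derivXn derivX.
rewrite -scaler_nat natr_card_pow // scale0r sub0r.
by rewrite -(scaleN1r 1) coprimepZr ?coprimep1 // oppr_eq0 oner_eq0.
Qed.

(** The field of [#|F| ^ k] elements, as a duplicate-free sequence. At k = 0 the
    polynomial 'X^(#|F| ^ k) - 'X vanishes and the value is a default one. *)
Definition fixed_points (k : nat) : seq K :=
  if boolP (0 < k)%N is AltTrue k_gt0
  then sval (separable_roots (separable_Xq_subX k_gt0)) else [::].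

Lemma fixed_pointsP k : (0 < k)%N ->
  [/\ uniq (fixed_points k), forall x, (x \in fixed_points k) = (frob k x == x)
    & size (fixed_points k) = (#|F| ^ k)%N].
Proof.
move=> k0; rewrite /fixed_points.
case: {-}_ / boolP => [k_gt0|]; last by rewrite k0.
case: (separable_roots _) => s [uniq_s mem_s /= size_s]; split=> // [x|].
  by rewrite mem_s -topredE /= /root !hornerE subr_eq0.
move: size_s; rewrite size_polyDl; last first.
  rewrite size_polyN size_polyX size_polyXn ltnS.
  rewrite (leq_trans (finNzRing_gt1 F)) // -{1}[#|F|]expn1 leq_pexp2l //.
  by rewrite ltnW ?finNzRing_gt1.
by rewrite size_polyXn => -[].
Qed.

(** The decision procedure for [period x n]. *)
Definition has_period (n : nat) (x : K) : bool :=
  (frob n x == x) &&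
  all (fun d => (frob d x == x) ==> (d == n)) (divisors n).

Lemma has_periodP n x : (0 < n)%N -> reflect (period x n) (has_period n x).
Proof.
move=> n_gt0; apply: (iffP andP) => [[/eqP xn /allP min_n]|per_x].
  have [d per_x] := period_exists n_gt0 xn; have [d_gt0 Pd] := per_x.
  have dn : (d %| n)%N by rewrite -Pd xn.
  have := min_n d; rewrite -dvdn_divisors // dn Pd dvdnn => /(_ isT)/eqP dnE.
  by rewrite -dnE.
have [_ Pn] := per_x; split; first by rewrite Pn.
apply/allP => d; rewrite -dvdn_divisors // Pn => dn.
by apply/implyP => nd; rewrite eqn_dvd dn.
Qed.

(** Moebius inversion over the lattice of subfields: the elements of degree n
    satisfying B are counted by the elements of each subfield satisfying B. *)
Lemma count_has_period n (B : pred K) : (0 < n)%N ->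
  (count (predI (has_period n) B) (fixed_points n))%:R =
  \sum_(e <- divisors n) moebius e *+ count B (fixed_points (n %/ e)) :> int.
Proof.
move=> n_gt0; have [uniq_n mem_n _] := fixed_pointsP n_gt0.
have ne_gt0 e : e \in divisors n -> (0 < n %/ e)%N.
  rewrite -dvdn_divisors // => en.
  by rewrite divn_gt0 ?(dvdn_gt0 n_gt0) // dvdn_leq.
have countE e : e \in divisors n -> count B (fixed_points (n %/ e)) =
    (\sum_(x <- fixed_points n) (B x && (frob (n %/ e) x == x)))%N.
  move=> en; have [uniq_ne mem_ne _] := fixed_pointsP (ne_gt0 e en).
  have -> : count B (fixed_points (n %/ e)) =
      count B [seq x <- fixed_points n | frob (n %/ e) x == x].
    apply/permP/uniq_perm; rewrite ?filter_uniq // => x.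
    rewrite mem_filter mem_n mem_ne; case: eqP => //= xe; apply/esym/eqP.
    by move: en; rewrite -dvdn_divisors // => /divnK <-; rewrite mulnC frob_mul.
  rewrite count_filter -sum1_count big_mkcond.
  by apply: eq_bigr => x _ /=; case: ifP.
rewrite big_seq; under eq_bigr => e en do rewrite countE // -sumrMnr.
rewrite -big_seq exchange_big /= -sum1_count big_mkcond natr_sum /=.
apply: eq_big_seq => x; rewrite mem_n => /eqP xn.
have [d per_x] := period_exists n_gt0 xn; have [_ Pd] := per_x.
have -> : has_period n x = (d == n).
  apply/has_periodP/eqP => // [per_n|<- //]; exact: period_inj per_x per_n.
case: (B x) => /=; last by rewrite andbF big1.
under eq_bigr do rewrite Pd.
rewrite sum_moebius_dvd -?Pd ?xn // andbT.
by case: (d == n).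
Qed.

(** * The trace to the prime field *)

(** For x in the field of [p ^ N] elements this is its trace to F_p. It is
    defined on all of K, so that the exponents can be split in [traceD]. *)
Definition trace (N : nat) (x : K) : K := \sum_(i < N) x ^+ (p ^ i).

Lemma exprD_p i (x y : K) : (x + y) ^+ (p ^ i) = x ^+ (p ^ i) + y ^+ (p ^ i).
Proof.
apply: exprDn_pchar; rewrite (eq_pnat _ (pcharf_eq charK)) pnatX pnat_id //.
exact: pcharf_prime charK.
Qed.

Lemma exprB_p i (x y : K) : (x - y) ^+ (p ^ i) = x ^+ (p ^ i) - y ^+ (p ^ i).
Proof.
by apply: (addIr (y ^+ (p ^ i))); rewrite -exprD_p !subrK.
Qed.

Lemma exprN_p i (x : K) : (- x) ^+ (p ^ i) = - x ^+ (p ^ i).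
Proof.
rewrite -[- x]sub0r exprB_p expr0n expn_eq0.
by rewrite (gtn_eqF (prime_gt0 (pcharf_prime charK))) sub0r.
Qed.

Lemma frobE k x : frob k x = x ^+ (p ^ (logn p #|F| * k)).
Proof. by rewrite /frob [X in (X ^ _)%N]card_pfield expnM. Qed.

Lemma traceD N M x : trace (N + M) x = trace N x + trace M (x ^+ (p ^ N)).
Proof.
rewrite /trace big_split_ord /=; congr (_ + _); apply: eq_bigr => i _.
by rewrite -exprM -expnD.
Qed.

(** The two telescoping sums behind additive Hilbert 90: the trace of
    [y ^+ p - y] and the Artin-Schreier image of the trace are the same. *)
Lemma trace_artin_schreier N y : trace N (y ^+ p - y) = y ^+ (p ^ N) - y.
Proof.
elim: N => [|N IHN]; first by rewrite /trace big_ord0 expr1 subrr.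
rewrite /trace big_ord_recr /= -/(trace N _) IHN exprB_p -exprM -expnS.
by rewrite addrC subrKA.
Qed.

Lemma artin_schreier_trace N x : trace N x ^+ p - trace N x = x ^+ (p ^ N) - x.
Proof.
have p_gt0 : (0 < p)%N := prime_gt0 (pcharf_prime charK).
elim: N => [|N IHN].
  by rewrite /trace big_ord0 expr1 expr0n gtn_eqF ?subrr.
have := exprD_p 1; rewrite expn1 => pD.
rewrite /trace big_ord_recr /= -/(trace N _) pD -exprM -expnSr.
by rewrite opprD addrACA IHN addrC subrKA.
Qed.

(** The trace to F_p from the field of [#|F| ^ k] elements. *)
Definition abs_trace (k : nat) (x : K) : K := trace (logn p #|F| * k) x.

(** Transitivity of the trace, at an element of the subfield. *)
Lemma abs_trace_mul m k x :
  frob k x = x -> abs_trace (m * k) x = abs_trace k x *+ m.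
Proof.
move=> xk; elim: m => [|m IHm].
  by rewrite /abs_trace muln0 /trace big_ord0.
rewrite mulSn /abs_trace mulnDr traceD -frobE xk -!/(abs_trace _ _) IHm.
by rewrite mulrS.
Qed.

Definition trace_poly (N : nat) : {poly K} := \sum_(i < N) 'X^(p ^ i).

Lemma root_trace_poly N x : root (trace_poly N) x = (trace N x == 0).
Proof.
by rewrite /root /trace_poly horner_sum; under eq_bigr do rewrite hornerXn.
Qed.

Lemma size_trace_poly N : size (trace_poly N.+1) = (p ^ N).+1.
Proof.
have p_gt1 := prime_gt1 (pcharf_prime charK).
elim: N => [|N IHN]; first by rewrite /trace_poly big_ord1 size_polyXn.
rewrite /trace_poly big_ord_recr /= -/(trace_poly _) addrC.
rewrite size_polyDl ?size_polyXn //.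
by rewrite IHN !ltnS ltn_exp2l.
Qed.

Lemma separable_trace_poly N : separable_poly (trace_poly N.+1).
Proof.
rewrite unlock /trace_poly big_ord_recl /= expn0 expr1 derivD derivX.
rewrite raddf_sum [X in 1 + X]big1 ?addr0 ?coprimep1 //= => i _.
by rewrite derivXn -scaler_nat natrX (pcharf0 charK) expr0n /= scale0r.
Qed.

(** The trace is a separable polynomial of degree [#|F| ^ k %/ p] all of whose
    roots are fixed by the k-th power of Frobenius, so a proportion [1 / p] of
    the fixed points has trace zero. *)
Lemma count_trace_neq0 k : (0 < k)%N ->
  (count (fun x => abs_trace k x != 0%R) (fixed_points k) * p =
   p.-1 * #|F| ^ k)%N.
Proof.
move=> k_gt0; have [uniq_k mem_k size_k] := fixed_pointsP k_gt0.
have p_gt0 : (0 < p)%N := prime_gt0 (pcharf_prime charK).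
have [N DN] : exists N, (logn p #|F| * k)%N = N.+1.
  case: (_ * _)%N (muln_gt0 (logn p #|F|) k) => [|N].
    by rewrite logn_card_gt0 k_gt0.
  by exists N.
have qkE : (#|F| ^ k = p * p ^ N)%N.
  by rewrite [X in (X ^ _)%N]card_pfield -expnM DN expnS.
have [s [uniq_s mem_s]] := separable_roots (separable_trace_poly N).
rewrite size_trace_poly => -[size_s].
have count0 : count (fun x => abs_trace k x == 0) (fixed_points k) = (p ^ N)%N.
  rewrite -size_s -size_filter; apply/perm_size/uniq_perm => [||x] //.
    exact: filter_uniq.
  rewrite mem_filter mem_k mem_s -[RHS]topredE /= root_trace_poly.
  rewrite /abs_trace DN; case: eqP => //= x0; rewrite frobE DN -subr_eq0.
  by rewrite -artin_schreier_trace x0 subr0 expf_eq0 p_gt0 eqxx.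
have := count_predC (fun x => abs_trace k x == 0) (fixed_points k).
rewrite count0 size_k qkE => /eqP.
rewrite -{1}[X in (X * _)%N](prednK p_gt0) mulSn.
rewrite eqn_add2l => /eqP; rewrite /predC /= => ->.
by rewrite mulnC mulnCA.
Qed.

(** Multiplication by u permutes the fixed points, and the trace in degree
    [d * k] is d times the trace in degree k, which is 0 if p divides d. *)
Lemma count_scaled_trace_neq0 d k (u : K) :
  (0 < k)%N -> u != 0 -> frob k u = u ->
  (count (fun x => abs_trace (d * k) (x * u)%R != 0%R) (fixed_points k) * p =
   if (p %| d)%N then 0 else p.-1 * #|F| ^ k)%N.
Proof.
move=> k_gt0 u0 uk; have [uniq_k mem_k _] := fixed_pointsP k_gt0.
have -> : count (fun x => abs_trace (d * k) (x * u) != 0) (fixed_points k) =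
    count (fun x => abs_trace (d * k) x != 0) (fixed_points k).
  rewrite -(count_map ( *%R^~ u) (fun x => abs_trace (d * k) x != 0)).
  apply/permP/uniq_perm => // [|x].
    by rewrite map_inj_uniq //; apply: mulIf.
  apply/mapP/idP => [[y yk ->]|xk]; last exists (x / u); rewrite ?divfK //.
    by move: yk; rewrite !mem_k rmorphM /= uk => /eqP->.
  by move: xk; rewrite !mem_k fmorph_div /= uk => /eqP->.
rewrite (dvdn_pcharf charK).
have trE : {in fixed_points k, forall x, (abs_trace (d * k) x != 0) =
    (d%:R != 0 :> K) && (abs_trace k x != 0)}.
  move=> x; rewrite mem_k => /eqP/abs_trace_mul->.
  by rewrite -(mulr_natl (abs_trace k x)) mulf_eq0 negb_or.
rewrite (eq_in_count trE); case: eqP => _; first by rewrite count_pred0.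
exact: count_trace_neq0.
Qed.

(** The trace of x to the fixed field of the k-th power of Frobenius is x - x,
    already in degree [k.*2]. *)
Lemma abs_trace_anti d k x : frob k x = - x -> abs_trace (d.*2 * k) x = 0.
Proof.
move=> xk; have x2k : frob (k + k) x = x.
  by rewrite frobD xk rmorphN /= xk opprK.
rewrite -muln2 -mulnA mul2n -addnn abs_trace_mul // /abs_trace mulnDr traceD.
rewrite -frobE xk -/(abs_trace k x).
suff -> : trace (logn p #|F| * k) (- x) = - abs_trace k x.
  by rewrite subrr mul0rn.
by rewrite /abs_trace /trace -sumrN; apply: eq_bigr => i _; apply: exprN_p.
Qed.

(** * Irreducibility of Artin-Schreier substitutions *)

(** If b is a root of [X ^+ p - c X = a] with [s ^+ p.-1 = c], then b / s solves
    the Artin-Schreier equation of a / s ^+ p. *)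
Lemma artin_schreier_root (c : F) (s a : K) : s != 0 -> s ^+ p.-1 = em c ->
  exists y : K, y ^+ p - y = a / s ^+ p /\ (y * s) ^+ p - em c * (y * s) = a.
Proof.
move=> s0 sc; have p_gt1 := prime_gt1 (pcharf_prime charK).
have [y] : exists y, root ('X^p - 'X - (a / s ^+ p)%:P) y.
  apply/closed_rootP.
  have : (size (- 'X - (a / s ^+ p)%:P)%R < size ('X^p : {poly K})%R)%N.
    rewrite size_polyXn ltnS -opprD size_polyN size_XaddC.
    exact: p_gt1.
  by move=> lt_p; rewrite -addrA size_polyDl // size_polyXn eqSS -lt0n ltnW.
rewrite /root !hornerE subr_eq0 => /eqP y_eq; exists y; split=> //.
have csE : em c * s = s ^+ p by rewrite -sc -exprSr (prednK (ltnW p_gt1)).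
by rewrite exprMn mulrCA csE -mulrBl y_eq divfK // expf_neq0.
Qed.

Lemma fixed_pow_p (x : K) j : x ^+ p = x -> frob j x = x.
Proof.
move=> xp; rewrite frobE; elim: (_ * _)%N => [|k IHk]; first by rewrite expr1.
by rewrite expnS exprM xp.
Qed.

Lemma frob_Xp j (x : K) : frob j (x ^+ p - x) = frob j x ^+ p - frob j x.
Proof. by rewrite rmorphB rmorphXn. Qed.

Section Substitution.

Variables (c : F) (s : K).
Hypotheses (s_neq0 : s != 0) (s_pow : s ^+ p.-1 = em c).
Variables (n : nat) (f : {poly F}) (a : K).
Hypotheses (n_gt0 : (0 < n)%N) (f_irr : irreducible_poly f).
Hypotheses (size_f : size f = n.+1) (root_a : root (map_poly em f) a).

Let g : {poly F} := 'X^p - c *: 'X.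

Let per_a : period a n.
Proof.
have [d per_d] := root_period (irredp_neq0 f_irr) root_a.
have /(irreducible_period root_a per_d) := f_irr.
by rewrite size_f => -[->].
Qed.

Let root_subst b : b ^+ p - em c * b = a -> root (map_poly em (f \Po g)) b.
Proof.
move=> ba; rewrite map_comp_poly /root horner_comp rmorphB /= map_polyXn.
by rewrite map_polyZ /= map_polyX !hornerE ba.
Qed.

Let size_subst : size (f \Po g) = (n * p).+1.
Proof.
have p_gt1 := prime_gt1 (pcharf_prime charK).
have size_g : size g = p.+1.
  rewrite size_polyDl ?size_polyXn // size_polyN.
  rewrite (leq_ltn_trans (size_scale_leq _ _)) //.
  by rewrite size_polyX ltnS.
have := size_comp_poly f g; rewrite size_f size_g /= => <-.
rewrite prednK // size_poly_gt0.
apply: contra_eq_neq (size_comp_poly f g) => ->.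
by rewrite size_poly0 size_f size_g /= eq_sym -lt0n muln_gt0 n_gt0 ltnW.
Qed.

(** Let [y * s] be a root of f o g as in [artin_schreier_root]. The n-th power
    of Frobenius translates y by the trace t of [a / s ^+ p], an element of F_p, so
    its k-th iterate translates y by [t *+ k]. Since n divides the period of
    [y * s], this period is n p if t is nonzero and n otherwise, while f o g has
    degree n p. *)
Lemma irreducible_subst : frob n s = s ->
  irreducible_poly (f \Po g) <-> abs_trace n (a / s ^+ p) != 0.
Proof.
move=> sn; have p_gt1 := prime_gt1 (pcharf_prime charK).
have [y [y_eq b_eq]] := artin_schreier_root a s_neq0 s_pow.
have root_b := root_subst b_eq; set b := y * s in b_eq root_b.
have [e per_b] : exists e, period b e.
  by apply: (root_period _ root_b); rewrite -size_poly_gt0 size_subst.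
have an := period_fix per_a.
have alpha_n : frob n (a / s ^+ p) = a / s ^+ p.
  by rewrite fmorph_div rmorphXn /= an sn.
pose t := abs_trace n (a / s ^+ p).
have yn : frob n y = y + t.
  by rewrite /t -y_eq /abs_trace trace_artin_schreier -frobE addrC subrK.
have tp : t ^+ p = t.
  apply/eqP; rewrite -subr_eq0 /t /abs_trace artin_schreier_trace -frobE.
  by rewrite alpha_n subrr.
have ykn k : frob (k * n) y = y + t *+ k.
  elim: k => [|k IHk]; first by rewrite frob0 addr0.
  rewrite mulSn frobD IHk rmorphD rmorphMn /= yn (fixed_pow_p n tp).
  by rewrite -addrA mulrS.
have bkn k : (frob (k * n) b == b) = (t *+ k == 0).
  rewrite rmorphM /= ykn (frob_mul k sn) /b (inj_eq (mulIf s_neq0)).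
  by rewrite -subr_eq0 addrC addKr.
have [e_gt0 Pe] := per_b.
have ne : (n %| e)%N.
  have [_ <-] := per_a; rewrite -b_eq rmorphB rmorphXn (rmorphM _ (em c)) /=.
  by rewrite frob_em (period_fix per_b).
have e_np : (e %| n * p)%N.
  by rewrite mulnC -Pe bkn -mulr_natr (pcharf0 charK) mulr0.
apply: (iff_trans (irreducible_period root_b per_b)); rewrite size_subst.
have := bkn 1%N; rewrite mul1n mulr1n Pe => <-; split=> [[<-]|not_en].
  apply/negP => /dvdn_leq => /(_ n_gt0).
  by rewrite leqNgt -{1}[n]muln1 ltn_pmul2l // p_gt1.
congr _.+1; case/dvdnP: ne e_np not_en => k ->.
rewrite mulnC dvdn_pmul2l // => kp not_kn.
have k1 : k != 1%N by apply: contraNneq not_kn => ->; rewrite muln1.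
by have /(prime_nt_dvdP (pcharf_prime charK) k1)-> := kp.
Qed.

(** The n-th power of Frobenius now maps y to z - y with z in F_p, and s to - s:
    both are involutions, so the period of the root [y * s] of f o g divides
    2 n, which is less than the degree n p. *)
Lemma reducible_subst : (2 < p)%N -> frob n s = - s ->
  ~ irreducible_poly (f \Po g).
Proof.
move=> p_gt2 sn.
have [y [y_eq b_eq]] := artin_schreier_root a s_neq0 s_pow.
have root_b := root_subst b_eq; set b := y * s in b_eq root_b.
have [e per_b] : exists e, period b e.
  by apply: (root_period _ root_b); rewrite -size_poly_gt0 size_subst.
have alpha_n : frob n (a / s ^+ p) = - (a / s ^+ p).
  rewrite fmorph_div rmorphXn /= (period_fix per_a) sn -[p]expn1 exprN_p.
  by rewrite invrN mulrN.
pose z := frob n y + y.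
have zp : z ^+ p = z.
  apply/eqP; rewrite -subr_eq0 /z.
  have := exprD_p 1; rewrite expn1 => ->.
  by rewrite opprD addrACA -frob_Xp y_eq alpha_n addNr.
have yn : frob n y = z - y by rewrite addrK.
have bnn : frob (n + n) b = b.
  rewrite rmorphM /= !frobD sn yn rmorphB rmorphN /= sn yn (fixed_pow_p n zp).
  by rewrite opprK opprB addrCA subrr addr0.
move/(irreducible_period root_b per_b); rewrite size_subst => -[np_e].
have [_ /(_ (n + n)%N)] := per_b; rewrite bnn eqxx -np_e addnn -muln2.
rewrite dvdn_pmul2l // => /esym/dvdn_leq.
by rewrite [(p <= 2)%N]leqNgt p_gt2 => /(_ isT).
Qed.

End Substitution.

(** * Counting polynomials by their roots *)

(** Each member of A has exactly n roots, all of degree n, and each element of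
    degree n is a root of exactly one monic irreducible polynomial. *)
Lemma card_by_roots n (A : {set {poly_n.+1 F}}) (P : pred K) : (0 < n)%N ->
  {in A, forall f : {poly_n.+1 F}, monic_irreducible n f} ->
  (forall (f : {poly_n.+1 F}) x, monic_irreducible n f ->
     root (map_poly em f) x -> (f \in A) = P x) ->
  (#|A| * n)%N = count (predI (has_period n) P) (fixed_points n).
Proof.
move=> n_gt0 irrA AP; have [uniq_n mem_n _] := fixed_pointsP n_gt0.
have periodE (f : {poly F}) x :
    monic_irreducible n f -> root (map_poly em f) x -> period x n.
  case=> _ size_f irr_f fx.
  have [d per_x] := root_period (irredp_neq0 irr_f) fx.
  by have /(irreducible_period fx per_x) := irr_f; rewrite size_f => -[->].
have count_roots f : f \in A ->
    n = (\sum_(x <- fixed_points n) root (map_poly em f) x)%N.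
  move=> /irrA irr_f; have [mon_f size_f f_irr] := irr_f.
  have [x fx] : exists x, root (map_poly em f) x.
    by apply/closed_rootP; rewrite size_map_poly size_f eqSS -lt0n.
  have per_x := periodE _ _ irr_f fx.
  have [m [mon_m size_m Dm root_m]] := minimal_poly per_x.
  have mf : m = f by apply: monic_dvd_eq; rewrite ?size_m -?root_m.
  rewrite -[LHS](size_mkseq (frob^~ x)).
  have /perm_size -> : perm_eq (mkseq (frob^~ x) n)
      [seq z <- fixed_points n | root (map_poly em f) z].
    apply: uniq_perm; rewrite ?filter_uniq ?uniq_orbit // => z.
    rewrite mem_filter -mf Dm root_prod_XsubC mem_n.
    rewrite andb_idr // => /mapP[j _ ->].
    by rewrite -frobD addnC frobD (period_fix per_x).
  rewrite size_filter -sum1_count big_mkcond.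
  by apply: eq_bigr => z _; case: ifP.
rewrite -sum_nat_const (eq_bigr _ count_roots) exchange_big /=.
rewrite -sum1_count [RHS]big_mkcond; apply: eq_bigr => x _ /=.
case: has_periodP => //= [per_x|not_per]; last first.
  rewrite big1 // => f /irrA irr_f; case: rootP => // /rootP fx.
  by case: not_per; apply: periodE fx.
have [m [mon_m size_m _ root_m]] := minimal_poly per_x.
have sm : m \is a poly_of_size n.+1 by rewrite qualifE /= size_m.
pose M := NPoly sm.
have irr_m : monic_irreducible n m.
  split=> //; apply/(irreducible_period _ per_x) => //; by rewrite root_m.
have root_M (f : {poly_n.+1 F}) : f \in A -> root (map_poly em f) x -> f = M.
  move=> /irrA[mon_f size_f _]; rewrite root_m => mf; apply/val_inj/esym.
  by apply: monic_dvd_eq; rewrite ?size_m.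
have MA : (M \in A) = P x by apply: AP; rewrite ?root_m.
case: ifP MA => [_ MA|_ MA].
  rewrite (bigD1 M) //= root_m dvdpp big1 ?addn0 // => f /andP[fA fM].
  by case: rootP => // /rootP/(root_M f fA) fE; rewrite fE eqxx in fM.
rewrite big1 // => f fA; case: rootP => // /rootP/(root_M f fA) fE.
by rewrite -fE fA in MA.
Qed.

End Frobenius.

(** * Evaluation of the counts *)

Lemma ratsubst_comp (F : fieldType) (g f : {poly F}) (n : nat) :
  size f = n.+1 -> ratsubst g 1 n f = f \Po g.
Proof.
move=> size_f; rewrite comp_polyE size_f /ratsubst; apply: eq_bigr => i _.
by rewrite expr1n mulr1.
Qed.

Lemma IsetP (F : finFieldType) (g : {poly F}) (n : nat) (f : {poly_n.+1 F}) :
  reflect (monic_irreducible n f /\ irreducible_poly (f \Po g))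
    (f \in Iset g 1 n).
Proof.
rewrite inE; apply: (iffP and4P) => [[mon_f /eqP size_f /irredP irr_f]|].
  by rewrite ratsubst_comp // => /irredP.
case=> -[mon_f size_f /irredP irr_f] /irredP.
by rewrite ratsubst_comp // size_f.
Qed.

(** Here C e stands for the number of elements of nonzero trace in the subfield
    of index e. The vanishing of C e for the e that do not divide m turns a sum
    of powers of q over the divisors of n into the sum of powers of q ^ t that
    defines [Ifun]. *)
Lemma necklace_of_sieve (p q t m n N : nat) (C : nat -> nat) :
  (0 < p)%N -> (0 < t)%N -> (0 < m)%N -> n = (t * m)%N ->
  (N * n)%:R = \sum_(e <- divisors n) moebius e *+ C e :> int ->
  (forall e, (e %| n)%N ->
    C e * p = if e %| m then p.-1 * q ^ (n %/ e) else 0)%N ->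
  N%:R = p.-1%:R / (p%:R * t%:R) * Ifun m%:R (q%:Z ^+ t) :> rat.
Proof.
move=> p_gt0 t_gt0 m_gt0 ->{n} sieve countC; rewrite IfunE //.
have nz k : (0 < k)%N -> k%:R != 0 :> rat by rewrite pnatr_eq0 -lt0n.
set S := \sum_(_ <- _) _.
have sieveQ : (N * (t * m))%:R * p%:R = p.-1%:R * S :> rat.
  have := congr1 (fun z : int => z%:~R * p%:R : rat) sieve.
  rewrite /= rmorph_nat => ->; rewrite rmorph_sum /= mulr_suml /S mulr_sumr.
  have tm_gt0 : (0 < t * m)%N by rewrite muln_gt0 t_gt0.
  have /(perm_big _) dE : perm_eq
      [seq e <- divisors (t * m) | (e %| m)%N] (divisors m).
    apply: uniq_perm; rewrite ?filter_uniq ?divisors_uniq // => e.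
    rewrite mem_filter -!dvdn_divisors // andb_idr // => em.
    exact: dvdn_mull.
  rewrite -[RHS]dE big_filter [RHS]big_mkcond.
  apply: eq_big_seq => e /=; rewrite -dvdn_divisors // => e_div.
  rewrite rmorphMn /= -(mulr_natr (moebius e)%:~R) -mulrA -natrM countC //.
  case: ifP => [em|]; last by rewrite mulr0.
  by rewrite -muln_divA // natrM natrX mulrCA -rmorphXn /= exprM !rmorphXn /=.
have -> : N%:R = (N * (t * m))%:R * p%:R / (p%:R * t%:R * m%:R) :> rat.
  by rewrite !natrM; field; rewrite !nz.
by rewrite sieveQ; field; rewrite !nz.
Qed.

Section Counting.

Variables (F : finFieldType) (K : closedFieldType) (em : {rmorphism F -> K}).
Variables (p : nat) (charF : p \in [pchar F]).
Variables (c : F) (s : K).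
Hypotheses (s_neq0 : s != 0) (s_pow : s ^+ p.-1 = em c).
Variables (n : nat).
Hypothesis (n_gt0 : (0 < n)%N).

Lemma Iset_sieve : frob F n s = s ->
  (#|Iset ('X^p - c *: 'X : {poly F}) 1 n| * n)%:R =
  \sum_(e <- divisors n) moebius e *+
     count (fun a => abs_trace F p n (a / s ^+ p) != 0)
       (fixed_points em charF (n %/ e)) :> int.
Proof.
move=> sn; rewrite -count_has_period //; congr _%:R; apply: card_by_roots => //.
  by move=> f /IsetP[].
move=> f x irr_f fx; have [mon_f size_f f_irr] := irr_f.
have substP := irreducible_subst charF s_neq0 s_pow n_gt0 f_irr size_f fx sn.
by apply/IsetP/idP => [[_ /substP]|/substP].
Qed.

Lemma Iset_empty : (2 < p)%N -> frob F n s = - s ->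
  #|Iset ('X^p - c *: 'X : {poly F}) 1 n| = 0%N.
Proof.
move=> p_gt2 sn; apply/eqP; rewrite cards_eq0 -subset0; apply/subsetP => f.
move=> /IsetP[[_ size_f f_irr] irr_subst].
have [x fx] : exists x, root (map_poly em f) x.
  by apply/closed_rootP; rewrite size_map_poly size_f eqSS -lt0n.
by case: (reducible_subst charF s_neq0 s_pow n_gt0 f_irr size_f fx p_gt2 sn).
Qed.

Lemma count_fixed_trace (e : nat) : (e %| n)%N -> frob F (n %/ e) s = s ->
  (count (fun a => abs_trace F p n (a / s ^+ p) != 0%R)
     (fixed_points em charF (n %/ e)) * p =
   if p %| e then 0 else p.-1 * #|F| ^ (n %/ e))%N.
Proof.
move=> en se; have e_gt0 := dvdn_gt0 n_gt0 en.
have ne_gt0 : (0 < n %/ e)%N by rewrite divn_gt0 // dvdn_leq.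
have u0 : (s ^+ p)^-1 != 0 by rewrite invr_neq0 ?expf_neq0.
have uk : frob F (n %/ e) (s ^+ p)^-1 = (s ^+ p)^-1.
  by rewrite /frob exprVn exprAC -/(frob F _ s) se.
have := count_scaled_trace_neq0 em charF e ne_gt0 u0 uk.
by rewrite [(e * _)%N]mulnC divnK.
Qed.

(** The case of a subfield which does not contain s: there a / s ^+ p lies in the
    quadratic extension, where [abs_trace_anti] applies. *)
Lemma count_antifixed_trace (e : nat) :
  (e %| n)%N -> ~~ odd e -> frob F (n %/ e) s = - s ->
  count (fun a => abs_trace F p n (a / s ^+ p) != 0)
    (fixed_points em charF (n %/ e)) = 0%N.
Proof.
move=> en even_e se; have e_gt0 := dvdn_gt0 n_gt0 en.
have ne_gt0 : (0 < n %/ e)%N by rewrite divn_gt0 // dvdn_leq.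
have [_ mem_ne _] := fixed_pointsP em charF ne_gt0.
rewrite (eq_in_count (a2 := pred0)) ?count_pred0 // => x.
rewrite mem_ne => /eqP xe.
have anti : frob F (n %/ e) (x / s ^+ p) = - (x / s ^+ p).
  rewrite /frob exprMn exprVn [(s ^+ p) ^+ _]exprAC -!/(frob F _ _) xe se.
  by have := exprN_p em charF 1 s; rewrite expn1 => ->; rewrite invrN mulrN.
have := abs_trace_anti em charF e./2 anti.
by rewrite even_halfK // [(e * _)%N]mulnC divnK // => ->; rewrite eqxx.
Qed.

End Counting.

Theorem theorem17 (F : finFieldType) (charF : 3%N \in [pchar F])
    (sigma : F) (sigma_nonsquare : forall x : F, x ^+ 2 <> sigma)
    (n : nat) (n_gt1 : (1 < n)%N) :
  #|Iset ('X^3 - 'X : {poly F}) 1 n|%:R =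
    2 / (3 * (n`_3)%N%:R) *
      Ifun (n%:R / (n`_3)%N%:R) (#|F|%:Z ^+ (n`_3)%N) :> rat
  /\
  #|Iset ('X^3 - sigma *: 'X : {poly F}) 1 n|%:R =
    1 / (3 * (n`_3)%N%:R) *
      Ifun (n%:R / (2 * (n`_3)%N%:R)) (#|F|%:Z ^+ (2 * (n`_3))%N) :> rat.
Proof.
have [K [em _]] := countable_algebraic_closure F.
have n_gt0 : (0 < n)%N := ltnW n_gt1.
set t := (n`_3)%N; set m := (n`_3^')%N.
have nE : n = (t * m)%N by rewrite partnC.
have t_gt0 : (0 < t)%N := part_gt0 _ _.
have m_gt0 : (0 < m)%N := part_gt0 _ _.
have co3m : coprime 3 m.
  by apply: (@pnat_coprime 3%N); rewrite ?pnat_id ?part_pnat.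
have coprime_t e : ~~ (3 %| e)%N -> coprime e t.
  by rewrite -prime_coprime // coprime_sym /t p_part => /(coprimeXr (logn 3 n)).
have not3 e : (e %| m)%N -> ~~ (3 %| e)%N.
  by move=> e_m; rewrite -prime_coprime // (coprime_dvdr e_m).
have nz k : (0 < k)%N -> k%:R != 0 :> rat by rewrite pnatr_eq0 -lt0n.
split.
  (* Here s = 1, and the divisors e of n prime to 3 are the divisors of m. *)
  have one_pow : (1 : K) ^+ 3.-1 = em 1 by rewrite expr1n rmorph1.
  have frob_1 k : frob F k (1 : K) = 1 by rewrite /frob expr1n.
  have := Iset_sieve charF (oner_neq0 K) one_pow n_gt0 (frob_1 n).
  rewrite scale1r => sieve.
  rewrite (necklace_of_sieve (p := 3) (q := #|F|) _ t_gt0 m_gt0 nE sieve)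
    // => [|e en].
    have -> // : n%:R / t%:R = m%:R :> rat.
    by rewrite nE natrM; field; rewrite nz.
  rewrite count_fixed_trace ?oner_neq0 //.
  have [e3|e3] := boolP (3 %| e)%N; first by case: ifP => // /not3; rewrite e3.
  by move: en; rewrite nE Gauss_dvdr ?coprime_t // => ->.
have [s s_root] : exists s : K, s ^+ 2 = em sigma.
  have : size ('X^2 - (em sigma)%:P) != 1%N by rewrite size_XnsubC.
  by case/closed_rootP => s; rewrite /root !hornerE subr_eq0 => /eqP; exists s.
have s_neq0 : s != 0.
  apply: contra_notN (sigma_nonsquare 0) => /eqP s0; apply: (fmorph_inj em).
  by rewrite -s_root s0 rmorphXn rmorph0.
(* Frobenius fixes the square of s but not s, which is not in F. *)
have frob1_s : frob F 1 s = - s.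
  have : (frob F 1 s) ^+ 2 == s ^+ 2.
    by rewrite /frob exprAC s_root -rmorphXn expn1 expf_card.
  rewrite eqf_sqr => /orP[/eqP/frob1_em -/(_ em)[x sx]|/eqP//].
  case: (sigma_nonsquare x); apply: (fmorph_inj em).
  by rewrite -s_root sx rmorphXn.
have frob_s k : frob F k s = (-1) ^+ k * s.
  elim: k => [|k IHk]; first by rewrite frob0 mul1r.
  have sign_em : em ((-1) ^+ k) = (-1) ^+ k by rewrite rmorphXn rmorphN1.
  rewrite -add1n frobD IHk -sign_em /frob exprMn -!/(frob F 1 _) frob1_s.
  by rewrite frob_em sign_em exprS mulrN mulN1r mulNr.
have [odd_n|even_n] := boolP (odd n).
  rewrite (Iset_empty charF s_neq0 s_root) //; last first.
    by rewrite frob_s -signr_odd odd_n mulN1r.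
  rewrite Ifun0 ?mulr0 // => -[k _ kE].
  have : n%:R == (k * (2 * t))%:R :> rat.
    by rewrite !natrM -kE divfK // -natrM nz ?muln_gt0.
  by rewrite eqr_nat => /eqP nk; move: odd_n; rewrite nk !oddM andbF.
(* The surviving e are those prime to 3 with n / e even. *)
have odd_t : odd t by rewrite /t p_part oddX orbT.
have mE : m = (2 * m./2)%N.
  by move: even_n; rewrite nE oddM odd_t mul2n => /even_halfK.
have t2_gt0 : (0 < 2 * t)%N by rewrite muln_gt0.
have m2_gt0 : (0 < m./2)%N by move: m_gt0; rewrite {1}mE muln_gt0.
have nE2 : n = (2 * t * m./2)%N by rewrite -mulnA mulnCA -mE.
have sign_s k : frob F k s = if odd k then - s else s.
  by rewrite frob_s -signr_odd; case: odd; rewrite ?mulN1r ?mul1r.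
have frob_n : frob F n s = s by rewrite sign_s (negPf even_n).
have sieve := Iset_sieve charF s_neq0 s_root n_gt0 frob_n.
rewrite (necklace_of_sieve (p := 3) (q := #|F|) _ t2_gt0 m2_gt0 nE2 sieve)
  // => [|e en].
  have -> : n%:R / (2 * t%:R) = m./2%:R :> rat.
    by rewrite nE2 !natrM; field; rewrite nz.
  by congr (_ * _); rewrite natrM /=; field; rewrite nz.
have [odd_ne|even_ne] := boolP (odd (n %/ e)).
  have even_e : ~~ odd e by move: even_n; rewrite -{1}(divnK en) oddM odd_ne.
  rewrite count_antifixed_trace ?sign_s ?odd_ne //; case: ifP => // e_m.
  by move: odd_ne; rewrite nE2 -muln_divA // !oddM.
rewrite count_fixed_trace ?sign_s ?(negPf even_ne) //.
have [e3|e3] := boolP (3 %| e)%N.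
  case: ifP => // e_m.
  by move: (not3 e); rewrite mE dvdn_mull // e3 => /(_ isT).
have co2 : coprime (2 * e) t by rewrite coprimeMl !coprime_t.
have : (2 * e %| 2 * m./2)%N.
  by rewrite -mE -(Gauss_dvdr m co2) -nE -dvdn_divRL ?dvdn2.
by rewrite dvdn_pmul2l // => ->.
Qed.
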